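(* Let $U\subset\mathbb{R}^d$ be open and let $s,\sigma\ge1$. Suppose that $\{a_j\}_{j=0}^\infty\subset\mathcal{G}^s_{\rm b}(U)$ is a formal $\mathcal{G}^{s,\sigma}$ symbol on $U$, i.e. there exists $C>0$ such that $\|\partial^\alpha a_j\|_{L^\infty(U)}\le C^{1+|\alpha|+j}\alpha!^sj!^\sigma$ for all $j\in\mathbb{N}$ and $\alpha\in\mathbb{N}^d$. Then there exist $a=a(\cdot\,;h)\in\mathcal{G}^s_{\rm b}(U)$ (for $h>0$) and $\widetilde C>0$ such that for any $\alpha\in\mathbb{N}^d$ and any integer $N>0$ we have, uniformly, $$\Bigl\|\partial^\alpha\Bigl(a-\sum_{j=0}^{N-1}a_jh^j\Bigr)\Bigr\|_{L^\infty(U)}\le\widetilde C^{1+|\alpha|+N}\alpha!^sN!^\sigma h^N.$$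
   Context: $\mathbb{N}=\{0,1,2,\dots\}$ and $h>0$ is a parameter; ''uniformly'' means that $\widetilde C$ is independent of $h$, $\alpha$ and $N$. $\mathcal{G}^s_{\rm b}(U)$ is the space of $u\in C^\infty(U)$ for which there exist $A,C>0$ with $|\partial^\alpha u(x)|\le AC^{|\alpha|}\alpha!^s$ for all $\alpha\in\mathbb{N}^d$ and all $x\in U$. *)

(* Defs.v *)
From HB Require Import structures.
From mathcomp Require Import all_boot all_order all_algebra.
From mathcomp Require Import complex.
From mathcomp Require Import all_classical all_reals all_analysis.
Set Implicit Arguments.
Unset Strict Implicit.
Unset Printing Implicit Defensive.
Import Order.TTheory GRing.Theory Num.Theory.
Import numFieldNormedType.Exports.
Local Open Scope classical_set_scope.
Local Open Scope ring_scope.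

Section Calculus.
Context {R : realType} {d : nat}.
Implicit Types (U A : set 'rV[R]_d) (u : 'rV[R]_d -> R[i]).

(* The library puts no normed-module structure on R[i], so complex-valued
   functions are differentiated through their real and imaginary parts. *)
Definition partial (i : 'I_d) u : 'rV[R]_d -> R[i] := fun x =>
  Complex ('D_(delta_mx 0 i) (fun y => complex.Re (u y)) x)
          ('D_(delta_mx 0 i) (fun y => complex.Im (u y)) x).

Definition iter_partial (l : seq 'I_d) u := foldr partial u l.

(* C^oo(U): all iterated partial derivatives, taken in any order, exist and are
   continuous at every point of U (which is meant to be open); the values of
   u outside U play no role. *)
Definition smooth_on U u : Prop :=
  forall (l : seq 'I_d) (x : 'rV[R]_d), U x ->
    [/\ {for x, continuous (fun y => complex.Re (iter_partial l u y))},
        {for x, continuous (fun y => complex.Im (iter_partial l u y))} &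
        forall i : 'I_d,
          derivable (fun y => complex.Re (iter_partial l u y)) x (delta_mx 0 i) /\
          derivable (fun y => complex.Im (iter_partial l u y)) x (delta_mx 0 i)].

Definition multi_index := {ffun 'I_d -> nat}.

Definition mi_order (alpha : multi_index) : nat := (\sum_(i < d) alpha i)%N.

Definition mi_fact (alpha : multi_index) : nat := (\prod_(i < d) (alpha i)`!)%N.

Definition mi_partial (alpha : multi_index) u : 'rV[R]_d -> R[i] :=
  foldr (fun i v => iter (alpha i) (partial i) v) u (enum 'I_d).

Definition gevrey_b (s : R) U u : Prop :=
  smooth_on U u /\
  exists A C : R, [/\ 0 < A, 0 < C &
    forall (alpha : multi_index) (x : 'rV[R]_d), U x ->
      ComplexField.Normc.normc (mi_partial alpha u x) <=
        A * C ^+ mi_order alpha * ((mi_fact alpha)%:R `^ s)].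

(* A box is given by a pair of opposite corners (a, b); it is empty, and has
   volume 0, as soon as b i < a i for some i. *)
Definition box (q : 'rV[R]_d * 'rV[R]_d) : set 'rV[R]_d :=
  [set x : 'rV[R]_d | forall i, q.1 0 i <= x 0 i <= q.2 0 i].

Definition box_volume (q : 'rV[R]_d * 'rV[R]_d) : R :=
  \prod_(i < d) Num.max 0 (q.2 0 i - q.1 0 i).

(* Lebesgue-null subsets of R^d; the library has no d-dimensional Lebesgue
   measure. *)
Definition lebesgue_null A : Prop :=
  forall e : R, 0 < e ->
    exists Q : set ('rV[R]_d * 'rV[R]_d),
      [/\ countable Q, A `<=` \bigcup_(q in Q) box q &
          (\esum_(q in Q) (box_volume q)%:E <= e%:E)%E].

(* Essential supremum of |u| over U, for Lebesgue measure. *)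
Definition Linf_norm U u : \bar R :=
  ereal_inf [set M%:E | M in [set M : R | 0 <= M /\
    lebesgue_null (U `&` [set x | M < ComplexField.Normc.normc (u x)])]].

Definition formal_gevrey_symbol (s sigma : R) U
    (a_ : nat -> 'rV[R]_d -> R[i]) : Prop :=
  exists2 C : R, 0 < C &
    forall (j : nat) (alpha : multi_index),
      (Linf_norm U (mi_partial alpha (a_ j)) <=
        (C ^+ (1 + mi_order alpha + j) *
         ((mi_fact alpha)%:R `^ s) * (j`!%:R `^ sigma))%:E)%E.

End Calculus.

Arguments multi_index : clear implicits.

(* Main.v *)
(** Truncate optimally: [a h] is the sum of the [a_j h^j] over [j < M], where
    [M] is the first index with [2 C h (M+1)^sigma > 1].  The bounds
    [t_j = C^j j!^sigma h^j] satisfy [t_(j+1) = C h (j+1)^sigma t_j], so they at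
    least halve at every step before [M] and at most halve at every step after
    it.  Hence the sum of the [t_j] between [M] and [N], on either side, is at
    most [2^(N+1) t_N], uniformly in [h]. *)
Require Import Defs.
From mathcomp Require Import all_boot all_order all_algebra.
From mathcomp Require Import complex.
From mathcomp Require Import all_classical all_reals all_analysis.
From mathcomp Require Import ring lra.
Import Order.TTheory GRing.Theory Num.Theory.
Import numFieldNormedType.Exports.
Local Open Scope classical_set_scope.
Local Open Scope ring_scope.

(** * Local calculus of a combination [f + g * c] *)

Section NearCombination.
Context {R : realType} {V : normedModType R} {f g w : V -> R} {c : R} {x : V}.
Context (wE : \forall y \near x, w y = f y + g y * c).

Let near_addZ : {near x, (f + c \*: g) =1 w}.
Proof. by apply: filterS wE => y ->; rewrite /= mulrC. Qed.

(** Continuity and directional derivatives depend only on the germ at [x]. Equality near [x] is the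
    form needed later, where formulas for iterated derivatives are known only on the open set
    [U]. *)
Lemma continuous_near_addZ : {for x, continuous f} -> {for x, continuous g} ->
  {for x, continuous w}.
Proof.
move=> fx gx; have := nbhs_singleton near_addZ.
rewrite /prop_for /continuous_at => <-.
apply: cvg_trans (near_eq_cvg near_addZ) _.
by apply: cvgD => //; apply: cvgZr.
Qed.

Lemma derivable_near_addZ v : derivable f x v -> derivable g x v ->
  derivable w x v.
Proof.
move=> fx gx; apply: near_eq_derivable near_addZ _.
by apply: derivableD => //; apply: derivableZ.
Qed.

Lemma derive_near_addZ v : derivable f x v -> derivable g x v ->
  'D_v w x = 'D_v f x + 'D_v g x * c.
Proof.
move=> fx gx; rewrite -(near_eq_derive v near_addZ).
rewrite deriveD ?deriveZ ?(mulrC _ c)//; exact: derivableZ.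
Qed.

End NearCombination.

(** * Iterated partial derivatives of combinations *)

Section Derivatives.
Context {R : realType} {d : nat}.
Implicit Types (U : set 'rV[R]_d) (u v : 'rV[R]_d -> R[i]).

Lemma ReDZ (z w : R[i]) (c : R) :
  complex.Re (z + w * (c%:C)%C) = complex.Re z + complex.Re w * c.
Proof. by case: z w => [a b] [a' b'] /=; rewrite mulr0 subr0. Qed.

Lemma ImDZ (z w : R[i]) (c : R) :
  complex.Im (z + w * (c%:C)%C) = complex.Im z + complex.Im w * c.
Proof. by case: z w => [a b] [a' b'] /=; rewrite mulr0 add0r. Qed.

(** Induction on [l]: since [U] is open, the formula for [l] holds near each of its points and can
    be differentiated once more. A real [c] acts on real and imaginary parts separately. *)
Lemma iter_partial_addZ {U u v} (c : R) : open U ->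
  smooth_on U u -> smooth_on U v -> forall l x, U x ->
  iter_partial l (fun y => u y + v y * (c%:C)%C) x =
  iter_partial l u x + iter_partial l v x * (c%:C)%C.
Proof.
move=> oU su sv; elim=> [//|i l IHl] x Ux /=.
have nearU : \forall y \near x, U y by exact: open_nbhs_nbhs.
have [_ _ /(_ i) [ure uim]] := su l x Ux.
have [_ _ /(_ i) [vre vim]] := sv l x Ux.
apply/eqP; rewrite eq_complex ReDZ ImDZ /partial /=; apply/andP; split; apply/eqP.
  by apply: derive_near_addZ => //; apply: filterS nearU => y /IHl ->; exact: ReDZ.
by apply: derive_near_addZ => //; apply: filterS nearU => y /IHl ->; exact: ImDZ.
Qed.

Lemma smooth_on_addZ {U u v} (c : R) : open U ->
  smooth_on U u -> smooth_on U v ->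
  smooth_on U (fun y => u y + v y * (c%:C)%C).
Proof.
move=> oU su sv l x Ux.
have nearU : \forall y \near x, U y by exact: open_nbhs_nbhs.
have [ur ui ud] := su l x Ux; have [vr vi vd] := sv l x Ux.
have reE : \forall y \near x,
    complex.Re (iter_partial l (fun y => u y + v y * (c%:C)%C) y) =
    complex.Re (iter_partial l u y) + complex.Re (iter_partial l v y) * c.
  by apply: filterS nearU => y Uy; rewrite (iter_partial_addZ c oU su sv) ?ReDZ.
have imE : \forall y \near x,
    complex.Im (iter_partial l (fun y => u y + v y * (c%:C)%C) y) =
    complex.Im (iter_partial l u y) + complex.Im (iter_partial l v y) * c.
  by apply: filterS nearU => y Uy; rewrite (iter_partial_addZ c oU su sv) ?ImDZ.
split; [exact: continuous_near_addZ reE _ _|exact: continuous_near_addZ imE _ _|].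
move=> i; have [? ?] := ud i; have [? ?] := vd i.
by split; [exact: derivable_near_addZ reE _ _ _|exact: derivable_near_addZ imE _ _ _].
Qed.

(** Transfers to [mi_partial] what is proved for [iter_partial] by induction on the list of
    directions. *)
Lemma mi_partialE (alpha : multi_index d) u : mi_partial alpha u =
  iter_partial (flatten [seq nseq (alpha i) i | i <- enum 'I_d]) u.
Proof.
rewrite /mi_partial /iter_partial; elim: (enum _) => [//|i s IHs] /=.
by rewrite foldr_cat -IHs; elim: (alpha i) => //= n ->.
Qed.

Lemma iter_partial0 (l : seq 'I_d) : iter_partial l (fun=> 0) = fun=> 0 :> R[i].
Proof.
elim: l => [//|i l] /= ->; apply/funext => x; rewrite /partial /=.
by rewrite (derive_cst (0 : R)).
Qed.

Lemma smooth_on0 U : smooth_on U (fun=> 0).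
Proof.
move=> l x _; rewrite iter_partial0 /=; split=> [||i]; try exact: cst_continuous.
by split; exact: (derivable_cst (0 : R)).
Qed.

(** An arbitrary index list allows induction by [cons] and covers both the truncated series and its
    remainders. *)
Definition lin_comb {I : Type} (r : seq I) (c : I -> R)
    (a_ : I -> 'rV[R]_d -> R[i]) : 'rV[R]_d -> R[i] :=
  fun x => \sum_(j <- r) a_ j x * ((c j)%:C)%C.

Lemma lin_comb_nil {I : Type} (c : I -> R) a_ : lin_comb [::] c a_ = fun=> 0.
Proof. by apply/funext => x; rewrite /lin_comb big_nil. Qed.

Lemma lin_comb_cons {I : Type} i (r : seq I) (c : I -> R) a_ :
  lin_comb (i :: r) c a_ = fun x => lin_comb r c a_ x + a_ i x * ((c i)%:C)%C.
Proof. by apply/funext => x; rewrite /lin_comb big_cons addrC. Qed.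

Lemma smooth_on_lin_comb U {I : Type} (r : seq I) (c : I -> R) a_ : open U ->
  (forall j, smooth_on U (a_ j)) -> smooth_on U (lin_comb r c a_).
Proof.
move=> oU sa; elim: r => [|i r IHr].
  rewrite lin_comb_nil; exact: smooth_on0.
by rewrite lin_comb_cons; exact: smooth_on_addZ.
Qed.

(** * Modulus estimates and stability of the Gevrey class *)

Lemma normc_real (c : R) : ComplexField.Normc.normc (c%:C)%C = `|c|.
Proof. by rewrite /= expr0n addr0 sqrtr_sqr. Qed.

Lemma le_normcDZ (z w : R[i]) (c : R) :
  ComplexField.Normc.normc (z + w * (c%:C)%C) <=
  ComplexField.Normc.normc z + `|c| * ComplexField.Normc.normc w.
Proof.
by apply: le_trans (le_normcD _ _) _; rewrite ComplexField.Normc.normcM normc_real mulrC.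
Qed.

Lemma normc_ge0 (z : R[i]) : 0 <= ComplexField.Normc.normc z.
Proof. by case: z => a b; exact: sqrtr_ge0. Qed.

Lemma gevrey_b0 (s : R) U : gevrey_b s U (fun=> 0).
Proof.
split; first exact: smooth_on0.
exists 1, 1; split=> // alpha x _.
rewrite mi_partialE iter_partial0 ComplexField.Normc.normc0.
by rewrite !mulr_ge0 ?exprn_ge0 ?powR_ge0.
Qed.

Lemma gevrey_b_addZ (s : R) {U u v} (c : R) : open U ->
  gevrey_b s U u -> gevrey_b s U v ->
  gevrey_b s U (fun y => u y + v y * (c%:C)%C).
Proof.
move=> oU [su [A [B [A0 B0 ub]]]] [sv [A' [B' [A'0 B'0 vb]]]].
split; first exact: smooth_on_addZ.
(* [B + B'] dominates both growth rates, so both bounds share one power and their prefactors add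
   up. *)
exists (A + `|c| * A'), (B + B'); split; [|exact: addr_gt0|].
  by rewrite ltr_wpDr// mulr_ge0// ltW.
move=> alpha x Ux; have := ub alpha x Ux; have := vb alpha x Ux.
rewrite !mi_partialE (iter_partial_addZ c oU su sv)// => {}vb {}ub.
apply: le_trans (le_normcDZ _ _ _) _.
rewrite 2!mulrDl; apply: lerD.
  apply: le_trans ub _; rewrite ler_wpM2r ?powR_ge0// ler_pM2l//.
  by rewrite lerXn2r ?nnegrE ?lerDl ?addr_ge0 ?ltW.
rewrite -!mulrA ler_wpM2l//; apply: le_trans vb _; rewrite -mulrA ler_pM2l//.
rewrite ler_wpM2r ?powR_ge0//.
by rewrite lerXn2r ?nnegrE ?lerDr ?addr_ge0 ?ltW.
Qed.

Lemma gevrey_b_lin_comb (s : R) U {I : Type} (r : seq I) (c : I -> R) a_ :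
  open U -> (forall j, gevrey_b s U (a_ j)) -> gevrey_b s U (lin_comb r c a_).
Proof.
move=> oU ga; elim: r => [|i r IHr].
  rewrite lin_comb_nil; exact: gevrey_b0.
by rewrite lin_comb_cons; exact: gevrey_b_addZ.
Qed.

(** * Null sets and the essential supremum *)

Lemma box_volume_ge0 (q : 'rV[R]_d * 'rV[R]_d) : 0 <= box_volume q.
Proof. by apply: prodr_ge0 => i _; rewrite le_max lexx. Qed.

Lemma lebesgue_null0 : lebesgue_null (set0 : set 'rV[R]_d).
Proof.
by move=> e e0; exists set0; split; rewrite ?esum_set0 ?lee_fin ?ltW.
Qed.

Lemma lebesgue_nullS {A B : set 'rV[R]_d} : A `<=` B ->
  lebesgue_null B -> lebesgue_null A.
Proof.
move=> AB nB e /nB [Q [cQ BQ Qe]]; exists Q; split=> //.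
exact: subset_trans BQ.
Qed.

Lemma lebesgue_nullU {A B : set 'rV[R]_d} :
  lebesgue_null A -> lebesgue_null B -> lebesgue_null (A `|` B).
Proof.
move=> nA nB e e0; have e20 : 0 < e / 2 by rewrite divr_gt0.
have [P [cP AP Pe]] := nA _ e20; have [Q [cQ BQ Qe]] := nB _ e20.
exists (P `|` Q); split.
- by rewrite -bigcup2E; apply: bigcup_countable => // -[|[|k]].
- by rewrite bigcup_setU; exact: setUSS.
have vol0 (q : 'rV[R]_d * 'rV[R]_d) : (0 <= (box_volume q)%:E)%E.
  by rewrite lee_fin; exact: box_volume_ge0.
(* The union of the covers splits into [P] and the boxes of [Q] outside [P], so common boxes are
   counted once; each part costs at most [e / 2]. *)
rewrite (esumID P)// [e]splitr EFinD; apply: leeD.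
  by rewrite setIUl setIid setUidl//; exact: subIsetr.
rewrite setIUl setICr set0U; apply: le_trans Qe.
by rewrite [leRHS](esumID (~` P))// leeDl// esum_ge0.
Qed.

(** An infimum at most [M] makes the superlevel sets null above every [M + e]; conversely each
    [M + e] is then an admissible bound. With this slack, sums of functions reduce to unions of two
    null sets. *)
Lemma Linf_norm_leP U u (M : R) : 0 <= M ->
  (Linf_norm U u <= M%:E)%E <->
  (forall e : R, 0 < e ->
     lebesgue_null (U `&` [set x | M + e < ComplexField.Normc.normc (u x)])).
Proof.
move=> M0; split=> [uM e e0|uM].
  have : (Linf_norm U u < (M + e)%:E)%E.
    by apply: le_lt_trans uM _; rewrite lte_fin ltrDl.
  case/ereal_inf_lt => _ [M' [M'0 nM'] <-]; rewrite lte_fin => /ltW M'M.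
  apply: lebesgue_nullS nM' => x [Ux] /= Mx; split=> //=.
  exact: le_lt_trans M'M Mx.
apply/lee_addgt0Pr => e e0; rewrite -EFinD; apply: ereal_inf_lbound.
exists (M + e) => //; split; last exact: uM.
by rewrite addr_ge0// ltW.
Qed.

Lemma Linf_norm_addZ {U u v w} (c A B : R) : 0 <= A -> 0 <= B ->
  (forall x, U x -> w x = u x + v x * (c%:C)%C) ->
  (Linf_norm U u <= A%:E)%E -> (Linf_norm U v <= B%:E)%E ->
  (Linf_norm U w <= (A + `|c| * B)%:E)%E.
Proof.
move=> A0 B0 wE /(Linf_norm_leP _ _ _ A0) uA /(Linf_norm_leP _ _ _ B0) vB.
apply/Linf_norm_leP => [|e e0]; first by rewrite addr_ge0 ?mulr_ge0.
(* The slack [e] is shared between [u] and [c v]; adding 1 keeps the divisor positive when [c] is 0.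
   Where neither [u] nor [v] exceeds its relaxed bound, neither does [w]. *)
have c1 : 0 < `|c| + 1 by rewrite ltr_wpDl.
have e20 : 0 < e / 2 by rewrite divr_gt0.
have ec0 : 0 < e / 2 / (`|c| + 1) by rewrite divr_gt0.
apply: lebesgue_nullS (lebesgue_nullU (uA _ e20) (vB _ ec0)) => x [Ux] /= wx.
case: (ltP (A + e / 2) (ComplexField.Normc.normc (u x))) => [ux|ux]; [by left|].
right; split=> //=; rewrite ltNge; apply/negP => vx.
move: wx; rewrite ltNge => /negP; apply; rewrite wE//.
apply: le_trans (le_normcDZ _ _ _) _.
apply: le_trans (lerD ux (ler_wpM2l (normr_ge0 c) vx)) _.
have : `|c| * (e / 2 / (`|c| + 1)) <= e / 2.
  by rewrite mulrCA ler_piMr ?ltW// ltr_pdivrMr// mul1r ltrDl.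
rewrite mulrDr; lra.
Qed.

Lemma Linf_norm0 U (M : R) : 0 <= M -> (Linf_norm U (fun=> 0%R) <= M%:E)%E.
Proof.
move=> M0; apply/Linf_norm_leP => // e e0.
apply: lebesgue_nullS lebesgue_null0 => x [_] /=.
by rewrite expr0n addr0 sqrtr0 ltNge addr_ge0// ltW.
Qed.

Lemma Linf_norm_mi_partial_lin_comb U {I : Type} (r : seq I) (c : I -> R) a_
    (alpha : multi_index d) (B : I -> R) :
  open U -> (forall j, smooth_on U (a_ j)) -> (forall j, 0 <= B j) ->
  (forall j, Linf_norm U (mi_partial alpha (a_ j)) <= (B j)%:E)%E ->
  (Linf_norm U (mi_partial alpha (lin_comb r c a_)) <=
     (\sum_(j <- r) `|c j| * B j)%:E)%E.
Proof.
move=> oU sa B0 aB; elim: r => [|i r IHr].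
  by rewrite lin_comb_nil mi_partialE iter_partial0 big_nil Linf_norm0.
rewrite lin_comb_cons big_cons [X in X%:E]addrC.
apply: Linf_norm_addZ IHr (aB i) => //; first by apply: sumr_ge0 => j _; rewrite mulr_ge0.
move=> x Ux; rewrite !mi_partialE; apply: (iter_partial_addZ _ oU) => //.
exact: smooth_on_lin_comb.
Qed.

End Derivatives.

(** * Almost geometric sums and the truncation index *)

Section AlmostGeometricSums.
Context {R : realType} {t : nat -> R} {M : nat}.
Context (t_ge0 : forall j, 0 <= t j).
Context (t_dec : forall j, (j < M)%N -> 2 * t j.+1 <= t j).
Context (t_inc : forall j, (M <= j)%N -> t j <= 2 * t j.+1).

Lemma sum_before_turn N : (N <= M)%N -> \sum_(N <= j < M) t j <= 2 * t N.
Proof.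
(* The extra [2 * t K] makes the induction close: [t K + 2 * t K.+1 <= 2 * t K] by [t_dec]. *)
move=> NM; suff : forall K, (N <= K <= M)%N ->
    \sum_(N <= j < K) t j + 2 * t K <= 2 * t N.
  by move=> /(_ M); rewrite NM leqnn => /(_ isT); have := t_ge0 M; lra.
elim=> [|K IHK] /andP[NK KM].
  by move: NK; rewrite leqn0 => /eqP ->; rewrite big_geq// add0r.
move: NK; rewrite leq_eqVlt => /predU1P[->|NK]; first by rewrite big_geq// add0r.
rewrite big_nat_recr//=; have := t_dec _ KM.
have := IHK; rewrite -ltnS NK ltnW// => /(_ isT); lra.
Qed.

Lemma sum_after_turn N : (M <= N)%N ->
  \sum_(M <= j < N) t j <= 2 ^+ N.+1 * t N.
Proof.
(* The factor 2^(N+1) - 2 solves K_(N+1) = 2 (K_N + 1) with K_0 = 0. *)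
move=> MN; suff : \sum_(M <= j < N) t j <= (2 ^+ N.+1 - 2) * t N.
  by have := t_ge0 N; rewrite mulrBl; lra.
have pow2 K : 2 <= 2 ^+ K.+1 :> R by rewrite exprS ler_peMr// exprn_ege1// ler1n.
elim: N MN => [|N IHN].
  by rewrite leqn0 => /eqP ->; rewrite big_geq// mulr_ge0// subr_ge0.
rewrite leq_eqVlt => /predU1P[->|].
  by rewrite big_geq// mulr_ge0// subr_ge0.
rewrite ltnS => MN; rewrite big_nat_recr//=; have {}IHN := IHN MN.
apply: (@le_trans _ _ ((2 ^+ N.+1 - 1) * t N)); first by rewrite mulrBl in IHN *; lra.
have p1 : 0 <= 2 ^+ N.+1 - 1 :> R by have := pow2 N; lra.
apply: le_trans (ler_wpM2l p1 (t_inc _ MN)) _.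
by rewrite (exprS _ N.+1) mulrA (_ : (_ - _) * 2 = 2 * 2 ^+ N.+1 - 2 :> R)//; ring.
Qed.

End AlmostGeometricSums.

(** The part depending on [j] of the symbol bound for the derivative of order [alpha] of
    [a_j h^j]. *)
Definition gevrey_term {R : realType} (sigma C h : R) (j : nat) : R :=
  C ^+ j * (j`!%:R `^ sigma) * h ^+ j.

Lemma gevrey_term_ge0 {R : realType} (sigma C h : R) j : 0 < C -> 0 < h ->
  0 <= gevrey_term sigma C h j.
Proof. by move=> C0 h0; rewrite !mulr_ge0 ?powR_ge0 ?exprn_ge0 ?ltW. Qed.

Lemma gevrey_termS {R : realType} (sigma C h : R) j :
  gevrey_term sigma C h j.+1 =
  gevrey_term sigma C h j * (C * h * (j.+1%:R `^ sigma)).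
Proof. by rewrite /gevrey_term factS natrM powRM// !exprS; ring. Qed.

Lemma optimal_truncation {R : realType} (sigma C h : R) :
  1 <= sigma -> 0 < C -> 0 < h ->
  exists M : nat,
    (forall j, (j < M)%N ->
       2 * gevrey_term sigma C h j.+1 <= gevrey_term sigma C h j) /\
    (forall j, (M <= j)%N ->
       gevrey_term sigma C h j <= 2 * gevrey_term sigma C h j.+1).
Proof.
move=> sigma1 C0 h0; set t := gevrey_term sigma C h.
have tS j : 2 * t j.+1 = t j * (2 * (C * h) * (j.+1%:R `^ sigma)).
  by rewrite /t gevrey_termS; ring.
have t0 j : 0 <= t j by exact: gevrey_term_ge0.
have x0 : 0 < 2 * (C * h) by rewrite !mulr_gt0.
have exM : exists M : nat, 1 < 2 * (C * h) * (M.+1%:R `^ sigma).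
  (* For this [M], [M.+1] exceeds [1 / (2 C h)], and its power [sigma] is at least as large because
     [sigma >= 1]. *)
  exists (Num.truncn (2 * (C * h))^-1); rewrite -ltr_pdivrMl// mulr1.
  by apply: lt_le_trans (truncnS_gt _) _; apply: le1r_powR => //; rewrite ler1n.
(* The factor in [tS] is at most 1 below [M] by minimality, and at least 1 from [M] on because it
   grows with [j]. *)
case: (ex_minnP exM) => M /ltW M1 minM; exists M; split=> j jM; rewrite tS.
  by rewrite ler_piMr// leNgt; apply/negP => /minM; rewrite leqNgt jM.
rewrite ler_peMr//; apply: le_trans M1 _; rewrite ler_pM2l//.
apply: ge0_ler_powR; rewrite ?nnegrE ?ler_nat//.
exact: le_trans ler01 sigma1.
Qed.

(** * The truncated series and its remainder *)

Theorem proposition2p4 (R : realType) (d : nat) (U : set 'rV[R]_d)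
    (s sigma : R) (a_ : nat -> 'rV[R]_d -> R[i]) :
  open U -> 1 <= s -> 1 <= sigma ->
  (forall j : nat, gevrey_b s U (a_ j)) ->
  formal_gevrey_symbol s sigma U a_ ->
  exists a : R -> 'rV[R]_d -> R[i],
    (forall h : R, 0 < h -> gevrey_b s U (a h)) /\
    exists2 C : R, 0 < C &
      forall (alpha : multi_index d) (N : nat) (h : R), (0 < N)%N -> 0 < h ->
        (Linf_norm U (mi_partial alpha
           (fun x => a h x - \sum_(j < N) a_ j x * ((h ^+ j)%:C)%C)%R) <=
         (C ^+ (1 + mi_order alpha + N) * ((mi_fact alpha)%:R `^ s) *
          (N`!%:R `^ sigma) * h ^+ N)%:E)%E.
Proof.
move=> oU _ sigma1 ga [C C0 aC].
have /choice [M MP] : forall h : R, exists M : nat, 0 < h ->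
    (forall j, (j < M)%N ->
       2 * gevrey_term sigma C h j.+1 <= gevrey_term sigma C h j) /\
    (forall j, (M <= j)%N ->
       gevrey_term sigma C h j <= 2 * gevrey_term sigma C h j.+1).
  (* For [h <= 0] the index 0 is a default value that carries no information. *)
  move=> h; case: (ltP 0 h) => [h0|_]; last by exists 0%N.
  by have [M MP] := optimal_truncation _ _ _ sigma1 C0 h0; exists M.
pose a h := lin_comb (index_iota 0 (M h)) (fun j => h ^+ j) a_.
exists a; split=> [h _|]; first exact: gevrey_b_lin_comb.
(* The factor 2 absorbs the [2 ^+ N.+1] from the geometric sums, and [1 + C] absorbs the powers of
   [C]. *)
exists (2 * (1 + C)); first by rewrite mulr_gt0// addr_gt0.
move=> alpha N h _ h0; have [dec inc] := MP h h0.
have t0 j : 0 <= gevrey_term sigma C h j by exact: gevrey_term_ge0.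
pose K := C ^+ (1 + mi_order alpha) * ((mi_fact alpha)%:R `^ s).
have K0 : 0 <= K by rewrite mulr_ge0 ?powR_ge0 ?exprn_ge0 ?ltW.
(* Only the modulus of the coefficients enters, so this serves both signs of the remainder. *)
have tail_bound (c : nat -> R) m n : (forall j, `|c j| = h ^+ j) ->
    \sum_(m <= j < n) gevrey_term sigma C h j <=
      2 ^+ N.+1 * gevrey_term sigma C h N ->
    (Linf_norm U (mi_partial alpha (lin_comb (index_iota m n) c a_)) <=
     ((2 * (1 + C)) ^+ (1 + mi_order alpha + N) * ((mi_fact alpha)%:R `^ s) *
          (N`!%:R `^ sigma) * h ^+ N)%:E)%E.
  move=> ch sumle; pose B j := C ^+ (1 + mi_order alpha + j) *
    ((mi_fact alpha)%:R `^ s) * (j`!%:R `^ sigma).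
  have B0 j : 0 <= B j by rewrite !mulr_ge0 ?powR_ge0 ?exprn_ge0 ?ltW.
  apply: le_trans
    (Linf_norm_mi_partial_lin_comb U (index_iota m n) c a_ alpha B oU _ B0 _) _.
  - by move=> j; case: (ga j).
  - by move=> j; exact: aC.
  rewrite lee_fin (eq_bigr (fun j => K * gevrey_term sigma C h j)); last first.
    by move=> j _; rewrite ch /B /K /gevrey_term (exprD _ _ j); ring.
  rewrite -mulr_sumr; apply: le_trans (ler_wpM2l K0 sumle) _.
  rewrite (_ : K * _ = (2 ^+ N.+1 * C ^+ (1 + mi_order alpha + N)) *
    ((mi_fact alpha)%:R `^ s) * (N`!%:R `^ sigma) * h ^+ N); last first.
    by rewrite /K /gevrey_term (exprD C _ N); ring.
  rewrite ler_wpM2r ?exprn_ge0 ?(ltW h0)//.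
  rewrite ler_wpM2r ?powR_ge0// ler_wpM2r ?powR_ge0// exprMn.
  apply: ler_pM; rewrite ?exprn_ge0 ?(ltW C0)//.
    by rewrite ler_eXn2l ?ltr1n// addnC addnA addn1 leq_addr.
  by rewrite lerXn2r ?nnegrE ?addr_ge0 ?lerDr ?ltW.
(* If [N <= M h], the remainder consists of the terms of [a h] from [N] on, with sum of bounds at
   most [2 t_N], and [2 <= 2 ^+ N.+1]. *)
case: (leqP N (M h)) => [NM|/ltnW MN].
  rewrite (_ : (fun x => _) = lin_comb (index_iota N (M h)) (fun j => h ^+ j) a_).
    apply: tail_bound => [j|]; first by rewrite ger0_norm ?exprn_ge0 ?ltW.
    apply: le_trans (sum_before_turn t0 dec N NM) _; rewrite ler_wpM2r//.
    by rewrite exprS ler_peMr// exprn_ege1// ler1n.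
  apply/funext => x; rewrite /a /lin_comb -(big_mkord xpredT
    (fun j => a_ j x * ((h ^+ j)%:C)%C)) [X in X - _](big_cat_nat (leq0n N) NM)//=.
  by rewrite addrAC subrr add0r.
(* Here [a h] stops before [N]: the remainder is minus the terms from [M h] to [N - 1], hence the
   negated coefficients. *)
rewrite (_ : (fun x => _) =
    lin_comb (index_iota (M h) N) (fun j => - h ^+ j) a_).
  apply: tail_bound => [j|]; first by rewrite normrN ger0_norm ?exprn_ge0 ?ltW.
  exact: sum_after_turn.
apply/funext => x; rewrite /a /lin_comb -(big_mkord xpredT
  (fun j => a_ j x * ((h ^+ j)%:C)%C)) [X in _ - X](big_cat_nat (leq0n (M h)) MN)//=.
rewrite opprD addrA subrr add0r -sumrN; apply: eq_bigr => j _.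
by rewrite rmorphN mulrN.
Qed.
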